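(* For every integer $n\ge1$, $\Omega(S_n)=\mathbb{R}_{<0}^n$.
   Context: $S_n$ is the combinatorial type with $n+1$ rays whose maximal cones are the subsets with $n$ elements of $\{1,\dots,n+1\}$ (i.e. the poset of nonempty proper subsets of $\{1,\dots,n+1\}$, the combinatorial type of the fan of $\mathbb{P}^n$). $\Omega(S_n)\subset\mathbb{R}^n$ is the set of vectors $v$ such that, with $h:\mathbb{Z}^{n+1}\to\mathbb{R}^n$ defined by $h(e_i)=e_i$ for $1\le i\le n$ and $h(e_{n+1})=v$, $h$ is $S_n$-admissible: the cones $\mathrm{Cone}(h(e_i),i\in I)$, $I\in S_n$, together with $\{0\}$, are strongly convex and form a fan (stable under faces; intersections are common faces) whose combinatorial type is $S_n$ (the combinatorial type of a fan being the poset of sets $I$ of generators such that $\mathrm{Cone}(h(e_i),i\in I)$ is a cone of the fan). No virtual generators. *)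

(* Defs.v *)
From HB Require Import structures.
From mathcomp Require Import all_boot all_order all_algebra.
From mathcomp Require Import boolp classical_sets cardinality reals.

Set Implicit Arguments.
Unset Strict Implicit.
Unset Printing Implicit Defensive.

Import Order.TTheory GRing.Theory Num.Theory.

Local Open Scope classical_set_scope.
Local Open Scope ring_scope.

Section Fans.
Variables (R : realType) (n : nat).
Implicit Types (s t : set 'rV[R]_n) (D : set (set 'rV[R]_n)).

(* The cone generated by no vector is [set 0]. *)
Definition Cone p (g : 'I_p -> 'rV[R]_n) (I : {set 'I_p}) : set 'rV[R]_n :=
  [set x | exists2 a : 'I_p -> R,
     (forall i, 0 <= a i) & x = \sum_(i in I) a i *: g i].

Definition polyhedral_cone s : Prop :=
  exists p (g : 'I_p -> 'rV[R]_n), s = Cone g [set: 'I_p]%SET.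

Definition strongly_convex s : Prop :=
  s `&` [set x | s (- x)] = [set 0].

(* Linear forms are column vectors m, acting by x |-> (x *m m) 0 0; a face is
   the intersection with the kernel of a form that is nonnegative on s, so s is
   a face of itself (m = 0). *)
Definition is_face t s : Prop :=
  exists2 m : 'cV[R]_n,
    (forall x, s x -> 0 <= (x *m m) 0 0) &
    t = s `&` [set x | (x *m m) 0 0 = 0].

(* No rationality condition: the generators are arbitrary real vectors. *)
Record is_fan D : Prop := IsFan {
  fan_finite : finite_set D;
  fan_neq0 : D !=set0;
  fan_polyhedral : forall s, D s -> polyhedral_cone s;
  fan_strongly_convex : forall s, D s -> strongly_convex s;
  fan_face : forall s t, D s -> is_face t s -> D t;
  fan_meet : forall s t, D s -> D t ->
    is_face (s `&` t) s /\ is_face (s `&` t) t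
}.

Section Admissible.
Variables (p : nat) (h : {additive 'rV[int]_p -> 'rV[R]_n}).

Definition gen (i : 'I_p) : 'rV[R]_n := h (delta_mx 0 i).

(* Only nonempty I are recorded, the zero cone being left implicit. *)
Definition comb_type D : set {set 'I_p} :=
  [set I | I != finset.set0 /\ D (Cone gen I)].

Definition cones_of (S : {set {set 'I_p}}) : set (set 'rV[R]_n) :=
  [set Cone gen I | I in [set` S]] `|` [set [set 0]].

Definition admissible (S : {set {set 'I_p}}) : Prop :=
  is_fan (cones_of S) /\ comb_type (cones_of S) = [set` S].

End Admissible.

Definition hmap (v : 'rV[R]_n) (m : 'rV[int]_(n + 1)) : 'rV[R]_n :=
  map_mx intr m *m col_mx 1%:M v.

Lemma hmap_is_zmod_morphism v : zmod_morphism (hmap v).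
Proof. by move=> x y; rewrite /hmap map_mxB mulmxBl. Qed.

HB.instance Definition _ v :=
  GRing.isZmodMorphism.Build 'rV[int]_(n + 1) 'rV[R]_n (hmap v)
    (hmap_is_zmod_morphism v).

Lemma hmap_lshift v (i : 'I_n) :
  hmap v (delta_mx 0 (lshift 1 i)) = delta_mx 0 i.
Proof. by rewrite /hmap map_delta_mx -rowE rowKu row1. Qed.

Lemma hmap_last v : hmap v (delta_mx 0 (rshift n ord0)) = v.
Proof. by rewrite /hmap map_delta_mx -rowE rowKd row_id. Qed.

Definition Omega (S : {set {set 'I_(n + 1)}}) : set 'rV[R]_n :=
  [set v | admissible (hmap v) S].

End Fans.

(* The order of the poset is inclusion; for n >= 1 the maximal elements are the
   n-element subsets. *)
Definition Sn (n : nat) : {set {set 'I_(n + 1)}} :=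
  [set I : {set 'I_(n + 1)} | (I != finset.set0) && (I \proper [set: 'I_(n + 1)])]%SET.

(* Main.v *)
Require Import Defs.
From mathcomp Require Import all_boot all_order all_algebra.
From mathcomp Require Import boolp classical_sets cardinality reals.

Set Implicit Arguments.
Unset Strict Implicit.
Unset Printing Implicit Defensive.

Import Order.TTheory GRing.Theory Num.Theory.

Local Open Scope classical_set_scope.
Local Open Scope ring_scope.

(** Write e_1, ..., e_n, v for the n + 1 generators.

    If all entries of v are negative, the linear relations between the
    generators form a line, spanned by v - sum_i v_i e_i = 0, all of whose
    coefficients are positive: the generators are a positive circuit.  This
    gives the fan.  Two nonnegative combinations with the same value differ by
    a multiple of the relation; if each of them omits some generator, that
    multiple is both nonnegative and nonpositive, so the combinations coincide
    ([circuit_unique]).  Hence a cone on a proper subset is strongly convex, and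
    two such cones meet in the cone on the common indices
    ([circuit_cone_strongly_convex], [circuit_coneI]).  Dually, any values on the
    generators that are orthogonal to the relation come from a linear form
    ([circuit_form]), so every subset of a proper subset I cuts out a face of
    the cone on I ([circuit_cone_face]).  The cone on all the generators is not
    strongly convex ([circuit_full_cone_not_strongly_convex]), so it is not in
    the fan, and the combinatorial type is the expected one.

    Conversely let the cones on proper subsets form a fan of the expected
    combinatorial type, and suppose v_k >= 0.  Move the negative entries of v to
    the other side:
      v + sum_(v_j < 0) (- v_j) e_j = sum_(v_j > 0) v_j e_j.
    The left side lies in the cone on N, made of v and the e_j with v_j < 0, and
    the right side in the cone on P, made of the e_j with v_j > 0; N is a proper
    subset because it omits e_k.  The meet of these cones is a face of the cone
    on N, and a face that contains a sum of two vectors of the cone contains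
    both ([face_summand]); so v lies in the cone on P.  But then all the
    generators together span the same cone as e_1, ..., e_n, and the full index
    set belongs to the combinatorial type: a contradiction. *)

(** * Cones and their faces *)

(** Coefficients that vanish outside I and are summed over all indices allow
    combinations supported on different subsets to be compared termwise. *)
Lemma coneP (R : realType) n p (g : 'I_p -> 'rV[R]_n) (I : {set 'I_p}) x :
  Cone g I x <->
  exists a : 'I_p -> R, [/\ forall i, 0 <= a i, forall i, i \notin I -> a i = 0
    & x = \sum_i a i *: g i].
Proof.
split=> [[a a0 ->]|[a [a0 aI ->]]].
  exists (fun i => if i \in I then a i else 0); split=> [i|i /negbTE->//|].
    by case: ifP.
  by rewrite big_mkcond; apply: eq_bigr => i _; case: ifP; rewrite ?scale0r.
exists a => //; rewrite [RHS]big_mkcond; apply: eq_bigr => i _.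
by case: ifPn => // /aI->; rewrite scale0r.
Qed.

Lemma cone_set0 (R : realType) n p (g : 'I_p -> 'rV[R]_n) :
  Cone g finset.set0 = [set 0].
Proof.
apply/seteqP; split=> x /=; first by case=> a _ ->; rewrite big_set0.
by move=> ->; exists (fun=> 0) => //; rewrite big_set0.
Qed.

Lemma cone_polyhedral (R : realType) n p (g : 'I_p -> 'rV[R]_n) I :
  polyhedral_cone (Cone g I).
Proof.
exists p, (fun i => if i \in I then g i else 0).
have E a : \sum_(i in I) a i *: g i =
    \sum_(i in [set: 'I_p]%SET) a i *: (if i \in I then g i else 0).
  rewrite big_mkcond [RHS]big_mkcond; apply: eq_bigr => i _.
  by rewrite inE; case: ifP => //; rewrite scaler0.
by apply/seteqP; split=> _ [a a0 ->]; exists a.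
Qed.

Lemma mem_cone (R : realType) n p (g : 'I_p -> 'rV[R]_n)
    (I : {set 'I_p}) i :
  i \in I -> Cone g I (g i).
Proof.
move=> iI; exists (fun j => (j == i)%:R) => [j|]; first exact: ler0n.
rewrite (bigD1 i) //= eqxx scale1r big1 ?addr0 // => j /andP[_ /negbTE->].
by rewrite scale0r.
Qed.

Lemma cone0 (R : realType) n p (g : 'I_p -> 'rV[R]_n) I : Cone g I 0.
Proof. by exists (fun=> 0) => //; rewrite big1 // => i; rewrite scale0r. Qed.

Lemma coneD (R : realType) n p (g : 'I_p -> 'rV[R]_n) I x y :
  Cone g I x -> Cone g I y -> Cone g I (x + y).
Proof.
move=> [a a0 ->] [b b0 ->]; exists (fun i => a i + b i) => [i|].
  exact: addr_ge0.
by rewrite -big_split; apply: eq_bigr => i _; rewrite scalerDl.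
Qed.

Lemma coneZ (R : realType) n p (g : 'I_p -> 'rV[R]_n) I r x :
  0 <= r -> Cone g I x -> Cone g I (r *: x).
Proof.
move=> r0 [a a0 ->]; exists (fun i => r * a i) => [i|]; first exact: mulr_ge0.
by rewrite scaler_sumr; apply: eq_bigr => i _; rewrite scalerA.
Qed.

Lemma cone_sum (R : realType) n p (g : 'I_p -> 'rV[R]_n) I
    (T : finType) (P : pred T) (b : T -> R) (f : T -> 'rV[R]_n) :
    (forall t, P t -> 0 <= b t) -> (forall t, P t -> Cone g I (f t)) ->
  Cone g I (\sum_(t | P t) b t *: f t).
Proof.
move=> b0 fI; apply: (big_ind (Cone g I)); [exact: cone0 | exact: coneD |].
by move=> t Pt; apply: coneZ; [exact: b0 | exact: fI].
Qed.

Lemma cone_subset (R : realType) n p (g : 'I_p -> 'rV[R]_n)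
    (I J : {set 'I_p}) :
  I \subset J -> Cone g I `<=` Cone g J.
Proof.
move=> /fintype.subsetP IJ _ [a a0 ->].
by apply: cone_sum => i // /IJ; apply: mem_cone.
Qed.

(** A form that is nonnegative at x and y and zero at x + y is zero at both. *)
Lemma face_summand (R : realType) n (s t : set 'rV[R]_n) x y :
  is_face t s -> s x -> s y -> t (x + y) -> t x.
Proof.
case=> m m0 -> sx sy [_ /= /eqP]; rewrite mulmxDl mxE.
by rewrite paddr_eq0 ?m0 // => /andP[/eqP].
Qed.

Lemma form_sum (R : realType) n p (g : 'I_p -> 'rV[R]_n) (a : 'I_p -> R)
    (m : 'cV[R]_n) :
  ((\sum_i a i *: g i) *m m) 0 0 = \sum_i a i * (g i *m m) 0 0.
Proof.
rewrite mulmx_suml summxE; apply: eq_bigr => i _.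
by rewrite -scalemxAl mxE.
Qed.

(** A form that is nonnegative on the generators takes the value 0 on a
    nonnegative combination only if every generator with a positive coefficient
    is in its kernel. *)
Lemma face_cone_form (R : realType) n p (g : 'I_p -> 'rV[R]_n)
    (I : {set 'I_p}) (m : 'cV[R]_n) :
    (forall i, i \in I -> 0 <= (g i *m m) 0 0) ->
  Cone g I `&` [set x | (x *m m) 0 0 = 0] =
  Cone g [set i in I | (g i *m m) 0 0 == 0]%SET.
Proof.
move=> m0; apply/seteqP; split=> x.
  case=> /coneP[a [a0 aI ->]] /=; rewrite form_sum => /eqP.
  have t0 i : true -> 0 <= a i * (g i *m m) 0 0.
    move=> _; case: (boolP (i \in I)) => [/m0 ?|/aI->]; last by rewrite mul0r.
    exact: mulr_ge0.
  rewrite psumr_eq0 // => /allP s0; apply/coneP; exists a; split=> // i.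
  rewrite inE negb_and => /orP[/aI//|mi].
  have := s0 i (mem_index_enum i); rewrite /= mulf_eq0 (negbTE mi) orbF.
  by move/eqP.
case/coneP=> a [a0 aJ ->]; split=> /=.
  apply/coneP; exists a; split=> // i iI; apply: aJ.
  by rewrite inE negb_and iI.
rewrite form_sum big1 // => i _.
have [|/aJ->] := boolP (i \in [set i in I | (g i *m m) 0 0 == 0]%SET).
  by rewrite inE => /andP[_ /eqP->]; rewrite mulr0.
by rewrite mul0r.
Qed.

Lemma face_cone (R : realType) n p (g : 'I_p -> 'rV[R]_n) I t :
  is_face t (Cone g I) -> exists2 J : {set 'I_p}, J \subset I & t = Cone g J.
Proof.
case=> m m0 ->; exists [set i in I | (g i *m m) 0 0 == 0]%SET.
  by apply/fintype.subsetP => i; rewrite inE => /andP[].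
by apply: face_cone_form => i /(mem_cone g)/m0.
Qed.

(** * Positive circuits *)

(** In matroid terms the g i form a circuit whose signs are all positive.  For
    n + 1 vectors this says that they are the vertices of a simplex with 0 in
    its interior. *)
Definition positive_circuit (R : realType) n p (g : 'I_p -> 'rV[R]_n)
    (c : 'I_p -> R) : Prop :=
  [/\ forall i, 0 < c i, \sum_i c i *: g i = 0 &
      forall a, \sum_i a i *: g i = 0 -> exists t, forall i, a i = t * c i].

(** The column space of a matrix is the annihilator of its row relations.  With
    the g i as rows of G and their relations spanning [kermx G], the column
    space of G is contained in the annihilator and has the same dimension. *)
Lemma circuit_form (R : realType) n p (g : 'I_p -> 'rV[R]_n) c
    (y : 'I_p -> R) :
    positive_circuit g c -> \sum_i c i * y i = 0 ->
  exists m : 'cV[R]_n, forall i, (g i *m m) 0 0 = y i.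
Proof.
move=> [_ _ crel] cy0; pose G := \matrix_i g i.
have Gsum (u : 'rV_p) : u *m G = \sum_i u 0 i *: g i.
  by rewrite mulmx_sum_row; apply: eq_bigr => i _; rewrite rowK.
pose Y : 'rV_p := \row_i y i.
have KY : Y *m (kermx G)^T = 0.
  apply: trmx_inj; rewrite trmx_mul trmxK trmx0; apply/row_matrixP => k.
  rewrite row_mul row0; set u := row k _.
  have [|t ut] := crel (u 0).
    by rewrite -Gsum -row_mul mulmx_ker row0.
  apply/rowP => j; rewrite mxE [RHS]mxE.
  transitivity (t * \sum_i c i * y i); last by rewrite cy0 mulr0.
  by rewrite mulr_sumr; apply: eq_bigr => i _; rewrite ut !mxE mulrA.
have GK : (G^T <= kermx (kermx G)^T)%MS.
  by apply/sub_kermxP; rewrite -trmx_mul mulmx_ker trmx0.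
have KG : (kermx (kermx G)^T <= G^T)%MS.
  rewrite -(geq_leqif (mxrank_leqif_sup GK)) !mxrank_ker !mxrank_tr mxrank_ker.
  by rewrite subKn // rank_leq_row.
have /submxP[D YD] : (Y <= G^T)%MS.
  by apply: submx_trans KG; apply/sub_kermxP.
exists D^T => i; have := congr1 (fun A : 'rV_p => A 0 i) YD.
rewrite !mxE => ->; apply: eq_bigr => j _.
by rewrite !mxE mulrC.
Qed.

(** The two sides differ by t times the relation: looking at the index k,
    missing on the left, gives t <= 0, and l, missing on the right, t >= 0. *)
Lemma circuit_unique (R : realType) n p (g : 'I_p -> 'rV[R]_n) c a b k l :
    positive_circuit g c -> (forall i, 0 <= a i) -> (forall i, 0 <= b i) ->
    a k = 0 -> b l = 0 -> \sum_i a i *: g i = \sum_i b i *: g i ->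
  a =1 b.
Proof.
move=> [c0 _ crel] a0 b0 ak bl /eqP; rewrite -subr_eq0 -sumrB => /eqP ab.
have [|t tc] := crel (fun i => a i - b i).
  by rewrite -[RHS]ab; apply: eq_bigr => i _; rewrite scalerBl.
suff t0 : t = 0 by move=> i; apply/eqP; rewrite -subr_eq0 tc t0 mul0r.
apply/eqP; rewrite eq_le -(pmulr_lle0 t (c0 k)) -(pmulr_lge0 t (c0 l)).
by rewrite -!tc ak bl sub0r subr0 oppr_le0 a0 b0.
Qed.

Lemma properTP (T : finType) (I : {set T}) :
  I \proper [set: T]%SET <-> exists k, k \notin I.
Proof.
split=> [/properP[_ [k _ kI]]|[k kI]]; first by exists k.
by apply/properP; split; [exact: finset.subsetT | exists k].
Qed.

(** If x and - x are combinations of generators in I, the sum of the two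
    combinations is a nonnegative relation omitting an index, hence trivial. *)
Lemma circuit_cone_strongly_convex (R : realType) n p
    (g : 'I_p -> 'rV[R]_n) c (I : {set 'I_p}) :
    positive_circuit g c -> I \proper [set: 'I_p]%SET ->
  strongly_convex (Cone g I).
Proof.
move=> gc /properTP[k kI]; apply/seteqP; split=> x /=; last first.
  move=> ->; rewrite oppr0; split; exact: cone0.
case=> /coneP[a [a0 aI xa]] /coneP[b [b0 bI xb]].
have ab : (fun i => a i + b i) =1 fun=> 0.
  apply: (circuit_unique (k := k) (l := k) gc) => //.
  - by move=> i; apply: addr_ge0.
  - by rewrite aI // bI // addr0.
  rewrite [RHS]big1 => [|i _]; last exact: scale0r.
  rewrite -[RHS](subrr x) [in RHS]xb {1}xa -big_split.
  by apply: eq_bigr => i _; rewrite scalerDl.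
rewrite xa big1 // => i _; have /eqP := ab i.
by rewrite /= paddr_eq0 // => /andP[/eqP->]; rewrite scale0r.
Qed.

(** The relation expresses - c k *: g k by the other generators. *)
Lemma circuit_full_cone_not_strongly_convex (R : realType) n p
    (g : 'I_p -> 'rV[R]_n) c k :
    positive_circuit g c -> g k != 0 ->
  ~ strongly_convex (Cone g [set: 'I_p]%SET).
Proof.
move=> [c0 crel _] gk0 /seteqP[sub _].
have inC i := mem_cone g (finset.in_setT i).
have : c k *: g k = 0.
  apply: sub; split=> /=.
    by apply: coneZ => //; apply: ltW.
  have -> : - (c k *: g k) = \sum_(i | i != k) c i *: g i.
    apply/eqP; rewrite eq_sym -addr_eq0 addrC -[X in _ == X]crel.
    by rewrite [X in _ == X](bigD1 k).
  by apply: cone_sum => i // _; apply: ltW.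
by move/eqP; rewrite scaler_eq0 (negbTE gk0) orbF gt_eqF.
Qed.

Lemma circuit_coneI (R : realType) n p (g : 'I_p -> 'rV[R]_n) c
    (I J : {set 'I_p}) :
    positive_circuit g c ->
    I \proper [set: 'I_p]%SET -> J \proper [set: 'I_p]%SET ->
  Cone g I `&` Cone g J = Cone g (I :&: J)%SET.
Proof.
move=> gc /properTP[k kI] /properTP[l lJ].
apply/seteqP; split=> x.
  case=> /coneP[a [a0 aI ->]] /coneP[b [b0 bJ abE]].
  have ab := circuit_unique gc a0 b0 (aI k kI) (bJ l lJ) abE.
  apply/coneP; exists a; split=> // i; rewrite inE negb_and => /orP[/aI//|/bJ].
  by rewrite ab.
move=> xIJ; split; apply: cone_subset xIJ; [exact: finset.subsetIl |].
exact: finset.subsetIr.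
Qed.

(** The form to use has value 0 on J and 1 on I minus J. *)
Lemma circuit_cone_face (R : realType) n p (g : 'I_p -> 'rV[R]_n) c
    (I J : {set 'I_p}) :
    positive_circuit g c -> I \proper [set: 'I_p]%SET -> J \subset I ->
  is_face (Cone g J) (Cone g I).
Proof.
move=> gc /properTP[k kI] /fintype.subsetP JI; have [c0 _ _] := gc.
pose z i : R := (i \notin J)%:R.
(* The value at k balances the relation; it is free since k is outside I. *)
pose y i : R := if i == k then - (\sum_(j | j != k) c j * z j) / c k else z i.
have [|m my] := circuit_form (y := y) gc.
  rewrite (bigD1 k) //= /y eqxx mulrCA divff ?mulr1 ?lt0r_neq0 //.
  rewrite addrC; apply/eqP; rewrite subr_eq0; apply/eqP.
  by apply: eq_bigr => i /negbTE->.
have mz i : i \in I -> (g i *m m) 0 0 = z i.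
  by move=> iI; rewrite my /y; case: eqP => // ik; rewrite -ik iI in kI.
have -> : J = [set i in I | (g i *m m) 0 0 == 0]%SET.
  apply/setP => i; rewrite inE; case: (boolP (i \in I)) => [iI|iI] /=.
    by rewrite mz // pnatr_eq0 eqb0 negbK.
  by apply: contraNF iI => /JI.
have m0 i : i \in I -> 0 <= (g i *m m) 0 0 by move=> iI; rewrite mz // ler0n.
exists m; last by rewrite face_cone_form.
move=> x /coneP[a [a0 aI ->]]; rewrite form_sum sumr_ge0 // => i _.
case: (boolP (i \in I)) => [/m0 ?|/aI->]; last by rewrite mul0r.
exact: mulr_ge0.
Qed.

(** * The fan of type S_n *)

(** The zero cone is the cone on the empty subset, which is proper; this removes
    the case distinction between it and the other cones. *)
Lemma cones_of_Sn (R : realType) n (h : {additive 'rV[int]_(n + 1) -> 'rV[R]_n})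
    s :
  cones_of h (Sn n) s <->
  exists2 I : {set 'I_(n + 1)},
    I \proper [set: 'I_(n + 1)]%SET & s = Cone (gen h) I.
Proof.
split=> [[[I /= + <-]|/= ->]|[I pI ->]].
- by rewrite inE => /andP[_ pI]; exists I.
- exists finset.set0; last by rewrite cone_set0.
  by apply/properTP; exists (rshift n ord0); rewrite inE.
have [->|I0] := eqVneq I finset.set0; first by right; rewrite cone_set0.
by left; exists I => //=; rewrite inE I0.
Qed.

Lemma circuit_admissible (R : realType) n
    (h : {additive 'rV[int]_(n + 1) -> 'rV[R]_n}) c k :
    positive_circuit (gen h) c -> gen h k != 0 ->
  admissible h (Sn n).
Proof.
move=> gc gk0; split; first split.
- rewrite finite_setU; split; last exact: finite_set1.
  exact: finite_image.
- by exists [set 0]; right.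
- by move=> s /cones_of_Sn[I _ ->]; apply: cone_polyhedral.
- by move=> s /cones_of_Sn[I pI ->]; apply: circuit_cone_strongly_convex gc pI.
- move=> s t /cones_of_Sn[I pI ->] /face_cone[J JI ->].
  by apply/cones_of_Sn; exists J => //; apply: sub_proper_trans JI pI.
- move=> s t /cones_of_Sn[I pI ->] /cones_of_Sn[J pJ ->].
  rewrite (circuit_coneI gc pI pJ).
  split; apply: (circuit_cone_face gc) => //;
    by rewrite ?finset.subsetIl ?finset.subsetIr.
apply/seteqP; split=> I /=; rewrite inE; last first.
  by case/andP=> I0 pI; split=> //; apply/cones_of_Sn; exists I.
case=> I0 /cones_of_Sn[J pJ IJ]; rewrite I0 /=.
rewrite properT; apply/eqP => IT.
apply: (circuit_full_cone_not_strongly_convex gc gk0); rewrite -IT IJ.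
exact: circuit_cone_strongly_convex gc pJ.
Qed.

Lemma sum_gen_hmap (R : realType) n (v : 'rV[R]_n) (a : 'I_(n + 1) -> R) j :
  (\sum_i a i *: gen (hmap v) i) 0 j =
  a (lshift 1 j) + a (rshift n ord0) * v 0 j.
Proof.
rewrite big_split_ord big_ord1 mxE /gen /= hmap_last mxE; congr (_ + _).
rewrite summxE (bigD1 j) //= hmap_lshift !mxE !eqxx mulr1 big1 ?addr0 //.
by move=> i ij; rewrite hmap_lshift !mxE eq_sym (negbTE ij) andbF mulr0.
Qed.

Lemma hmap_circuit (R : realType) n (v : 'rV[R]_n) :
    (forall i, v 0 i < 0) ->
  exists c, positive_circuit (gen (hmap v)) c.
Proof.
move=> v0; pose c (i : 'I_(n + 1)) : R :=
  if split i is inl j then - v 0 j else 1.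
have cl j : c (lshift 1 j) = - v 0 j by rewrite /c (unsplitK (inl j)).
have cr : c (rshift n ord0) = 1 by rewrite /c (unsplitK (inr ord0)).
exists c; split.
- by move=> i; rewrite /c; case: (split i) => // j; rewrite oppr_gt0.
- by apply/rowP => j; rewrite sum_gen_hmap cl cr mul1r addNr mxE.
move=> a a0; exists (a (rshift n ord0)) => i.
rewrite -(splitK i); case: (split i) => j /=; last by rewrite (ord1 j) cr mulr1.
have /rowP/(_ j) := a0; rewrite sum_gen_hmap mxE => /eqP.
by rewrite addr_eq0 cl mulrN => /eqP.
Qed.

(** A nonnegative entry of v would put v in the cone generated by the basis
    vectors, by means of the meet of the cones on N and P below. *)
Lemma admissible_neg (R : realType) n (v : 'rV[R]_n) :
  admissible (hmap v) (Sn n) -> forall i, v 0 i < 0.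
Proof.
move=> [fanD typeD] k; rewrite ltNge; apply/negP => vk.
set h := hmap v in fanD typeD; pose l := rshift n ord0 : 'I_(n + 1).
have gl : gen h l = v by exact: hmap_last.
have gs j : gen h (lshift 1 j) = delta_mx 0 j by exact: hmap_lshift.
pose N := [set l]%SET :|: [set lshift 1 j | j : 'I_n & v 0 j < 0]%SET.
pose P := [set lshift 1 j | j : 'I_n & 0 < v 0 j]%SET.
have lP : l \notin P.
  by apply/imsetP => -[j _ /eqP]; rewrite eq_sym eq_lrshift.
have pN : N \proper [set: 'I_(n + 1)]%SET.
  apply/properTP; exists (lshift 1 k); rewrite !inE eq_lrshift /=.
  by apply/imsetP => -[j + /lshift_inj kj]; rewrite inE -kj ltNge vk.
have pP : P \proper [set: 'I_(n + 1)]%SET.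
  by apply/properTP; exists l.
have DN : cones_of h (Sn n) (Cone (gen h) N) by apply/cones_of_Sn; exists N.
have DP : cones_of h (Sn n) (Cone (gen h) P) by apply/cones_of_Sn; exists P.
have [faceN _] := fan_meet fanD DN DP.
pose w : 'rV[R]_n := \sum_(j | v 0 j < 0) (- v 0 j) *: delta_mx 0 j.
have /(mem_cone (gen h)) : l \in N by rewrite !inE eqxx.
rewrite gl => Nv.
have Nw : Cone (gen h) N w.
  apply: cone_sum => j vj; first by rewrite oppr_ge0 ltW.
  by rewrite -gs; apply: mem_cone; rewrite !inE imset_f ?orbT // inE.
have Pvw : Cone (gen h) P (v + w).
  have -> : v + w = \sum_(j | 0 < v 0 j) v 0 j *: delta_mx 0 j.
    rewrite {1}[v]row_sum_delta [X in _ + X]big_mkcond.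
    rewrite -big_split [RHS]big_mkcond.
    apply: eq_bigr => j _ /=; case: (ltgtP (v 0 j)) => [_|_|->].
    - by rewrite scaleNr addrN.
    - by rewrite addr0.
    - by rewrite scale0r addr0.
  apply: cone_sum => j vj; first exact: ltW.
  by rewrite -gs; apply: mem_cone; rewrite imset_f // inE.
have [_ Pv] := face_summand faceN Nv Nw (conj (coneD Nv Nw) Pvw).
have Pl : P \subset [set~ l]%SET.
  by rewrite finset.subsetC finset.sub1set inE.
(* As v is generated by the basis vectors, the set of all indices and the
   complement of l give the same cone, which belongs to the fan. *)
have : [set` Sn n] [set: 'I_(n + 1)]%SET.
  rewrite -typeD; split; first by apply/finset.set0Pn; exists l; rewrite inE.
  apply/cones_of_Sn; exists [set~ l]%SET.
    by apply/properTP; exists l; rewrite !inE eqxx.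
  apply/seteqP; split=> x.
    case=> a a0 ->; apply: cone_sum => // i _.
    have [->|il] := eqVneq i l; first by rewrite gl; apply: cone_subset Pv.
    by apply: mem_cone; rewrite !inE.
  exact/cone_subset/finset.subsetT.
by rewrite /= inE fintype.properxx andbF.
Qed.

Theorem lemma2p3p1 (R : realType) (n : nat) (hn : (1 <= n)%N) :
  Omega (Sn n) = [set v : 'rV[R]_n | forall i : 'I_n, v 0 i < 0].
Proof.
apply/seteqP; split=> v /=; first exact: admissible_neg.
move=> /hmap_circuit[c gc]; pose k := Ordinal hn.
apply: (circuit_admissible (k := lshift 1 k) gc).
rewrite /gen /= hmap_lshift; apply/eqP => /rowP/(_ k)/eqP.
by rewrite !mxE !eqxx oner_eq0.
Qed.
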